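(* Let $\lambda$ be a $k$-small partition, $\lambda\neq\varnothing$, and put $l=n-\lambda'_1+1$ and $r=\lambda_1$ (so $r<l$). Let $M_\lambda$ be the square matrix of size $n-l+1+r$, with rows indexed by $l,\dots,n$ followed by $1^\dagger,\dots,r^\dagger$ and columns indexed by $l,l+1,\dots,n+r$, defined by: the entry in row $p\in[l,n]$ and column $q$ is $z_{pq}$ (with $z_{pq}=0$ for $q<p$); the entry in row $s^\dagger$ ($1\le s\le r$) and column $q$ is $(-1)^m f_m^{\langle m,s\rangle;\lambda}$ if $q=n+s-m$ with $0\le m\le\lambda'_s$ (where $f_0^{\langle 0,s\rangle;\lambda}:=1$), and $0$ otherwise. Then $$\tilde g^{(k)}_\lambda(y|b)=\frac{\det M_\lambda}{\xi_\lambda(y)},\qquad \xi_\lambda(y)=\prod_{i=1}^{\lambda'_1}\Omega(b_{1-i}|y).$$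
   Context: Fix $n\ge2$, $k=n-1$. Let $R(T)=\mathbb{Z}[e^{\pm a_1},\dots,e^{\pm a_n}]/(e^{a_1+\cdots+a_n}-1)$; subscripts of $a_i,b_i$ are taken modulo $n$ with representatives in $\{1,\dots,n\}$; $b_i=1-e^{-a_i}$. Let $\hat\Lambda$ be the ring of symmetric formal power series in $y=(y_1,y_2,\dots)$ with coefficients in the fraction field of $R(T)$, and $\Omega(b_i|y)=\prod_{j\ge1}(1-b_iy_j)^{-1}$. For $1\le i\le n-1$, $s_i$ acts on $\hat\Lambda$ by exchanging $a_i,a_{i+1}$ in the coefficients; $s_\theta$ exchanges $a_1,a_n$; $s_0(f)=\frac{\Omega(b_1|y)}{\Omega(b_n|y)}s_\theta(f)$. Put $\alpha_i=a_i-a_{i+1}$ ($1\le i\le n-1$), $\alpha_0=a_n-a_1$, $T_i=(1-e^{\alpha_i})^{-1}(s_i-1)$, $D_i=T_i+1$; $D_x$ is defined via reduced words in the affine symmetric group $\hat W=\langle s_0,\dots,s_{n-1}\rangle$, and $\tilde g^{(k)}_x(y|b)=D_x(1)$ for $x$ in the set $\hat W^0$ of minimal-length representatives of $\hat W/S_n$. The $n$-residue of the box in row $r$, column $c$ of a Young diagram is $c-r\bmod n$. A partition $\lambda$ is $k$-small if $\lambda_1+\ell(\lambda)\le n$; then $\lambda$ corresponds to $x_\lambda\in\hat W^0$ obtained by adding the boxes of $\lambda$ one at a time (each new diagram a partition), a box of residue $i$ contributing a left factor $s_i$; $\tilde g^{(k)}_\lambda=\tilde g^{(k)}_{x_\lambda}$.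 For a box $(i,j)\in\lambda$ put $\mathfrak d(i,j)=\{e^{-a_{j-s}}: i\le s\le\lambda'_j\}$ and $f_m^{\langle i,j\rangle;\lambda}=h_m(\mathfrak d(i,j))$ (complete homogeneous symmetric polynomial). The elements $z_{pq}$ ($1\le p\le q\le p+n-1$) are defined by $z_{pp}=\Omega(b_p|y)$ and recursively $z_{pq}=\frac{z_{p,q-1}-z_{p+1,q}}{e^{-a_q}-e^{-a_p}}$ for $p<q$ (subscripts of $a$, $b$ mod $n$). *)

(* Defs.v *)
From HB Require Import structures.
From mathcomp Require Import all_boot all_order all_algebra.
From mathcomp Require Import fraction.
From mathcomp Require Import mpoly.

Set Implicit Arguments.
Unset Strict Implicit.
Unset Printing Implicit Defensive.

Import Order.TTheory GRing.Theory Num.Theory.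
Local Open Scope ring_scope.

Definition is_partition (la : seq nat) : bool :=
  sorted geq la && all (fun x => 0 < x)%N la.
Definition conj_part (la : seq nat) (j : nat) : nat :=
  count (fun x => j <= x)%N la.
Definition k_small (n : nat) (la : seq nat) : bool :=
  (head 0%N la + size la <= n)%N.
Definition in_diagram (la : seq nat) (b : nat * nat) : bool :=
  [&& 0 < b.1, b.1 <= size la, 0 < b.2 & b.2 <= nth 0 la b.1.-1]%N.
Definition building_seq (la : seq nat) (w : seq (nat * nat)) : bool :=
  [&& uniq w, all (in_diagram la) w, size w == sumn la &
   all (fun k => let b := nth (0,0)%N w k in
          ((1 < b.1)%N ==> ((b.1.-1, b.2) \in take k w)) &&
          ((1 < b.2)%N ==> ((b.1, b.2.-1) \in take k w)))
       (iota 0 (size w))].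

Section Model.
Variable n : nat.

Definition Kf := {fraction {mpoly int[n.-1]}}.

Definition xv (i : nat) : Kf :=
  if (insub i : option 'I_(n.-1)) is Some j then tofrac 'X_j
  else (\prod_(j < n.-1) (tofrac ('X_j : {mpoly int[n.-1]})))^-1.

Definition ea (p : int) : Kf := xv (absz ((p - 1) %% n)%Z).

Definition subst (pi : nat -> nat) (p : {mpoly int[n.-1]}) : Kf :=
  mmap (fun c : int => c%:~R) (fun j : 'I_(n.-1) => xv (pi (val j))) p.
Definition act (pi : nat -> nat) (x : Kf) : Kf :=
  subst pi (\n_(repr x)) / subst pi (\d_(repr x)).
Definition swapn (i j : nat) : nat -> nat :=
  fun k => if k == i then j else if k == j then i else k.
Definition s_coef (i : nat) : Kf -> Kf := act (swapn i.-1 i).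
Definition stheta_coef : Kf -> Kf := act (swapn 0 n.-1).

Definition bb (p : int) : Kf := 1 - (ea p)^-1.
Definition ealpha (i : nat) : Kf :=
  if i == 0%N then ea n%:Z / ea 1 else ea i%:Z / ea (i.+1)%:Z.

Fixpoint hcompl (m : nat) (xs : seq Kf) : Kf :=
  match xs with
  | [::] => if m == 0%N then 1 else 0
  | x :: xs' => \sum_(j < m.+1) x ^+ j * hcompl (m - j) xs'
  end.

Variables N D : nat.
Local Notation A := {mpoly Kf[N]}.

Definition trunc (p : A) : A :=
  \sum_(m <- msupp p | (mdeg m <= D)%N) p@_m *: 'X_[m].
Definition cmap (f : Kf -> Kf) (p : A) : A :=
  \sum_(m <- msupp p) f p@_m *: 'X_[m].
Definition hsym (d : nat) : A :=
  \sum_(m : 'X_{1..N < d.+1} | mdeg m == d) 'X_[m].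
Definition Omega (b : Kf) : A := \sum_(d < D.+1) b ^+ d *: hsym d.
Definition Omega_inv (b : Kf) : A := \prod_(j < N) (1 - b *: 'X_j).

Definition s_op (i : nat) (f : A) : A :=
  if i == 0%N then trunc (Omega (bb 1) * Omega_inv (bb n%:Z) * cmap stheta_coef f)
  else cmap (s_coef i) f.
Definition D_op (i : nat) (f : A) : A :=
  (1 - ealpha i)^-1 *: (s_op i f - f) + f.

Definition residue (b : nat * nat) : nat := absz ((b.2%:Z - b.1%:Z) %% n)%Z.
Definition gtilde (w : seq (nat * nat)) : A :=
  foldl (fun f b => D_op (residue b) f) 1 w.

Fixpoint zz (p : int) (d : nat) : A :=
  match d with
  | 0 => Omega (bb p)
  | d'.+1 => ((ea (p + d'.+1%:Z))^-1 - (ea p)^-1)^-1 *: (zz p d' - zz (p + 1) d')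
  end.

Definition dset (la : seq nat) (i j : nat) : seq Kf :=
  [seq (ea (j%:Z - s%:Z))^-1 | s <- iota i (conj_part la j - i).+1].

Definition Mrow_dagger (la : seq nat) (s : nat) (q : int) : Kf :=
  let m := (n%:Z + s%:Z - q)%R in
  if (0 <= m) && (m <= (conj_part la s)%:Z) then
    (-1) ^+ absz m * (if absz m == 0%N then 1 else hcompl (absz m) (dset la (absz m) s))
  else 0.

Definition Mmat (la : seq nat) : 'M[A]_(size la + head 0%N la) :=
  let l := (n - size la + 1)%N in
  \matrix_(i, j)
    (let q := (l + j)%N in
     if (i < size la)%N then
       (let p := (l + i)%N in if (q < p)%N then 0 else zz p%:Z (q - p))
     else (Mrow_dagger la (i - size la).+1 q%:Z)%:MP).

Definition xi (la : seq nat) : A := \prod_(i < size la) Omega (bb (1 - (i.+1)%:Z)).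

End Model.

(* Main.v *)
(* Put u_p = e^{-a_p}, so that z_pq is, up to the sign (-1)^(q-p), the divided
   difference at u_p, ..., u_q of the function u |-> Omega(1 - u | y).  The dagger
   entries are also divided differences: with c = n + s - la'_s, the entry in row s
   and column q is (up to the same sign) the divided difference of u^(la'_s) at
   u_c, ..., u_q.  Thus every row of M_la is the list of divided differences of one
   function F that start at one position p.

   Multiplication by xi_la turns s_0 into the plain exchange of u_n and u_{n+1}, so
   D_i becomes G |-> (1 - u_{t+1}/u_t)^-1 (s G - G) + G, with s the exchange of two
   adjacent nodes u_t, u_{t+1}.  On a row of divided differences s acts by one column
   operation, the same for all rows, except that a row starting at t+1 receives in
   addition (u_{t+1} - u_t) times the row of the same function started at t; for an
   Omega row this addition is a row operation, which the determinant ignores.  By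
   Leibniz' rule the operator therefore replaces, inside the determinant, the row
   (F, t+1) by the row (-uF, t), and that is exactly the effect on M_la of adding a
   box to column s.  For the empty partition the matrix is triangular with
   determinant xi_la. *)

Require Import Defs.
From HB Require Import structures.
From mathcomp Require Import all_boot all_order all_algebra.
From mathcomp Require Import fraction.
From mathcomp Require Import mpoly.
From mathcomp Require Import ring zify.
Import GRing.Theory.
Local Open Scope ring_scope.

Set Implicit Arguments.
Unset Strict Implicit.
Unset Printing Implicit Defensive.

(** * Divided differences *)

Section DividedDifferences.

Variables (K : fieldType) (B : comNzRingType) (io : {rmorphism K -> B}).
Variable v : nat -> K.

(* The sign convention is that of z_pq: the usual divided difference is (-1)^d dd F p d. *)
Fixpoint dd (F : nat -> B) (p d : nat) : B :=
  if d is d'.+1 then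
    io (v (p + d'.+1)%N - v p)^-1 * (dd F p d' - dd F p.+1 d')
  else F p.

Lemma eq_dd F G p d : F =1 G -> dd F p d = dd G p d.
Proof. by move=> h; elim: d p => [|d IH] p /=; rewrite ?h ?IH. Qed.

Definition ddrow F p q : B := if (q < p)%N then 0 else dd F p (q - p).

Variable W : nat.
Hypothesis v_inj : forall s t, (s < W)%N -> (t < W)%N -> v s = v t -> s = t.

Lemma io_subK s t : (s < W)%N -> (t < W)%N -> s <> t ->
  io (v t - v s)^-1 * (io (v t) - io (v s)) = 1.
Proof.
move=> hs ht hst; rewrite -rmorphB -rmorphM mulVf ?rmorph1 // subr_eq0.
by apply/eqP => /v_inj h; apply: hst; rewrite h.
Qed.

Lemma dd_rec F p d : (p + d.+1 < W)%N ->
  (io (v (p + d.+1)%N) - io (v p)) * dd F p d.+1 = dd F p d - dd F p.+1 d.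
Proof.
move=> h; have hK := @io_subK p (p + d.+1)%N ltac:(lia) h ltac:(lia).
by rewrite [dd F p d.+1]/= mulrA [X in X * _]mulrC hK mul1r.
Qed.

Lemma mul_dd_inj s t x y : (s < W)%N -> (t < W)%N -> s <> t ->
  (io (v t) - io (v s)) * x = (io (v t) - io (v s)) * y -> x = y.
Proof.
move=> hs ht hst h.
by rewrite -[x]mul1r -[y]mul1r -(io_subK hs ht hst) -!mulrA h.
Qed.

(** The first divided difference of u is 1 and the higher ones vanish, so only two terms of Leibniz'
    rule survive. The factor -u combined with the sign (-1)^d of [dd] produces the signs on the
    right. *)
Lemma dd_leibniz F p d : (p + d.+1 < W)%N ->
  dd (fun t => - io (v t) * F t) p d.+1 = dd F p.+1 d - io (v p) * dd F p d.+1.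
Proof.
elim: d p => [|d IH] p h.
  apply: (@mul_dd_inj p (p + 1)%N); try lia.
  rewrite dd_rec // mulrBr [X in _ = _ - X]mulrCA dd_rec // /= addn1; ring.
apply: (@mul_dd_inj p (p + d.+2)%N); try lia.
rewrite dd_rec // !IH; try lia.
rewrite mulrBr [X in _ = _ - X]mulrCA dd_rec //.
have H := @dd_rec F p.+1 d ltac:(lia); rewrite addSnnS in H.
have -> : dd F p.+1 d = dd F p.+2 d + (io (v (p + d.+2)%N) - io (v p.+1)) * dd F p.+1 d.+1.
  by rewrite H; ring.
ring.
Qed.

Lemma ddrow_leibniz F p q : (q < W)%N ->
  ddrow (fun t => - io (v t) * F t) p q = ddrow F p.+1 q - io (v p) * ddrow F p q.
Proof.
move=> hq; rewrite /ddrow.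
have [lt_qp|lt_pq|->] := ltngtP q p; last 1 first.
- by rewrite ltnSn subnn /=; ring.
- by rewrite ltnS (ltnW lt_qp); ring.
have [d E] : exists d, q = (p + d.+1)%N by exists (q - p).-1; lia.
subst q.
have -> : (p + d.+1 < p.+1)%N = false by lia.
have -> : (p + d.+1 - p = d.+1)%N by lia.
have -> : (p + d.+1 - p.+1 = d)%N by lia.
by rewrite dd_leibniz.
Qed.

(** * Exchange of two adjacent nodes *)

Section Swap.

Variables (sK : {rmorphism K -> K}) (sB : {rmorphism B -> B}).
Hypothesis sB_io : forall c, sB (io c) = io (sK c).
Variable t0 : nat.
Hypothesis ht0 : (t0.+1 < W)%N.

(** Only positions below [W] are constrained: the nodes will be periodic modulo n, so an exchange
    may also move nodes further out. *)
Definition swapped (T : Type) (f : T -> T) (F : nat -> T) : Prop :=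
  [/\ f (F t0) = F t0.+1, f (F t0.+1) = F t0 &
      forall t, (t < W)%N -> t <> t0 -> t <> t0.+1 -> f (F t) = F t].

Hypothesis sv : swapped sK v.

Local Notation V t := (io (v t)).

Lemma sB_V : swapped sB (fun t => V t).
Proof.
by case: sv => h1 h2 h3; split=> [||t *]; rewrite sB_io ?h1 ?h2 ?h3.
Qed.

Section SwapRow.

Variable F : nat -> B.
Hypothesis sF : swapped sB F.

Lemma dd_swap_out p d : (p + d < W)%N -> (p + d < t0)%N || (t0.+1 < p)%N ->
  sB (dd F p d) = dd F p d.
Proof.
case: sF => _ _ hF; case: sv => _ _ hv.
elim: d p => [|d IH] p h h'; first by apply: hF; lia.
rewrite /= rmorphM rmorphB sB_io fmorphV rmorphB !IH; try lia.
by rewrite !hv //; lia.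
Qed.

(** Divided differences are symmetric in their nodes. One ending at [t0] has its last node replaced,
    which changes it by a multiple of the next one; one ending at [t0.+1] contains both nodes and is
    fixed. The second claim needs the first at the same [p], hence the joint induction. *)
Lemma dd_swap_left k p : (p + k = t0)%N ->
  sB (dd F p k) = dd F p k - (V t0.+1 - V t0) * dd F p k.+1 /\
  sB (dd F p k.+1) = dd F p k.+1.
Proof.
case: sB_V => h1 h2 h3; case: sF => f1 f2 f3.
elim: k p => [|k IH] p hp.
  rewrite addn0 in hp; subst p.
  have E : (V t0.+1 - V t0) * dd F t0 1 = F t0 - F t0.+1.
    by have := @dd_rec F t0 0; rewrite addn1 => ->.
  split; first by rewrite E /= f1; ring.
  (* The multiplier is the image under [sB] of the factor in [dd_rec], so the recurrence can be
     applied inside [sB]. The inductions below use the same device. *)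
  apply: (@mul_dd_inj t0.+1 t0); try lia.
  rewrite -[X in (X - _) * sB _]h2 -[X in (_ - X) * sB _]h1 -rmorphB -rmorphM E.
  by rewrite rmorphB f1 f2 -[RHS]opprK -mulNr opprB E opprB.
have [hA hB] := IH p.+1 ltac:(lia).
have R1 := @dd_rec F p k ltac:(lia); have R2 := @dd_rec F p k.+1 ltac:(lia).
rewrite hp in R1; have e2 : (p + k.+2 = t0.+1)%N by lia.
rewrite e2 in R2.
have hp3 : sB (V p) = V p by apply: h3; lia.
have A : sB (dd F p k.+1) = dd F p k.+1 - (V t0.+1 - V t0) * dd F p k.+2.
  apply: (@mul_dd_inj p t0.+1); try lia.
  rewrite -[X in (X - _) * sB _]h1 -[X in (_ - X) * sB _]hp3 -rmorphB -rmorphM R1.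
  rewrite rmorphB hA dd_swap_out; try lia.
  have -> : dd F p.+1 k.+1 = dd F p k.+1 - (V t0.+1 - V p) * dd F p k.+2.
    by rewrite R2; ring.
  have -> : dd F p k = dd F p.+1 k + (V t0 - V p) * dd F p k.+1 by rewrite R1; ring.
  ring.
split=> //; apply: (@mul_dd_inj p t0); try lia.
rewrite -[X in (X - _) * sB _]h2 -[X in (_ - X) * sB _]hp3 -rmorphB -rmorphM R2.
rewrite rmorphB hB A.
have -> : dd F p.+1 k.+1 = dd F p k.+1 - (V t0.+1 - V p) * dd F p k.+2.
  by rewrite R2; ring.
ring.
Qed.

(** Mirror image of [dd_swap_left]: now the first node is replaced. *)
Lemma dd_swap_right d : (t0.+1 + d < W)%N ->
  sB (dd F t0.+1 d) = dd F t0.+1 d - (V t0 - V t0.+1) * dd F t0 d.+1.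
Proof.
case: sB_V => h1 h2 h3; case: sF => f1 f2 f3.
elim: d => [|d IH] h.
  have E := @dd_rec F t0 0 ltac:(lia); rewrite addn1 in E.
  have -> : sB (dd F t0.+1 0) = F t0.+1 + (dd F t0 0 - dd F t0.+1 0) by rewrite /= f2; ring.
  by rewrite -E [dd F t0.+1 0]/=; ring.
have R1 := @dd_rec F t0 d.+1 ltac:(lia); have R2 := @dd_rec F t0.+1 d ltac:(lia).
rewrite -addSnnS in R1.
apply: (@mul_dd_inj t0 (t0.+1 + d.+1)%N); try lia.
have h3' : sB (V (t0.+1 + d.+1)%N) = V (t0.+1 + d.+1)%N by apply: h3; lia.
rewrite -[X in (X - _) * sB _]h3' -[X in (_ - X) * sB _]h2 -rmorphB -rmorphM R2.
rewrite rmorphB IH; last lia.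
rewrite dd_swap_out; try lia.
have -> : dd F t0.+1 d = dd F t0.+2 d +
   (V (t0.+1 + d.+1)%N - V t0.+1) * dd F t0.+1 d.+1 by rewrite R2; ring.
have -> : dd F t0 d.+1 = dd F t0.+1 d.+1 +
   (V (t0.+1 + d.+1)%N - V t0) * dd F t0 d.+2 by rewrite R1; ring.
ring.
Qed.

(** Symmetry when both nodes occur. In the recurrence both shorter differences again contain both
    nodes, except when the range ends at [t0.+1] or starts at [t0]; these cases come from the two
    preceding lemmas. *)
Lemma dd_swap_mid d p : (p <= t0)%N -> (t0 < p + d)%N -> (p + d < W)%N ->
  sB (dd F p d) = dd F p d.
Proof.
case: sB_V => h1 h2 h3.
elim: d p => [|d IH] p hp hq hW; first by lia.
have [e|ne] := eqVneq (p + d)%N t0; first by case: (dd_swap_left e).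
have R1 := @dd_rec F p d ltac:(lia).
have hq3 : sB (V (p + d.+1)%N) = V (p + d.+1)%N by apply: h3; lia.
have [e|ne'] := eqVneq p t0.
  subst p; apply: (@mul_dd_inj t0.+1 (t0 + d.+1)%N); try lia.
  rewrite -[X in (X - _) * sB _]hq3 -[X in (_ - X) * sB _]h1 -rmorphB -rmorphM R1.
  rewrite rmorphB IH; try lia.
  rewrite dd_swap_right; try lia.
  have -> : dd F t0 d = dd F t0.+1 d +
    (V (t0 + d.+1)%N - V t0) * dd F t0 d.+1 by rewrite R1; ring.
  ring.
have hp3 : sB (V p) = V p by apply: h3; lia.
apply: (@mul_dd_inj p (p + d.+1)%N); try lia.
rewrite -[X in (X - _) * sB _]hq3 -[X in (_ - X) * sB _]hp3 -rmorphB -rmorphM R1.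
rewrite rmorphB !IH //; lia.
Qed.

(** [R] is the row with its correction in case it starts at [t0.+1]. What remains subtracts a
    multiple of column [t0.+1] from column [t0], with a coefficient independent of the row, hence a
    column operation on the whole matrix. *)
Lemma ddrow_swap p q : (p < W)%N -> (q < W)%N ->
  sB (ddrow F p q) =
  let R q' := ddrow F p q' + (if p == t0.+1 then (V t0.+1 - V t0) * ddrow F t0 q' else 0) in
  R q - (if q == t0 then (V t0.+1 - V t0) * R t0.+1 else 0).
Proof.
move=> hp hq; rewrite /ddrow /=.
have [lt_qp|le_pq] := ltnP q p.
  rewrite rmorph0.
  have [e|ne] := eqVneq p t0.+1; last first.
    have -> : (if q == t0 then (V t0.+1 - V t0) *
      ((if (t0.+1 < p)%N then 0 else dd F p (t0.+1 - p)) + 0) else 0) = 0.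
      by case: eqP => // e; rewrite ifT ?addr0 ?mulr0 //; lia.
    by rewrite addr0 subr0.
  subst p; rewrite ltnn !ltnNge leqnSn /= subnn.
  have [e|ne] := eqVneq q t0; last by rewrite -ltnNge ifT ?mulr0 ?subr0 ?addr0 //; lia.
  (* Here [R t0.+1] equals [F t0], so the correction in column [t0] cancels against the column
     operation and the entry stays 0. *)
  subst q; rewrite leqnn subnn subSnn.
  have E := @dd_rec F t0 0 ltac:(lia); rewrite addn1 in E.
  by rewrite E /=; ring.
have [e|ne] := eqVneq p t0.+1.
  subst p; rewrite dd_swap_right; last lia.
  have /negPf -> : q != t0 by lia.
  have -> : (q < t0)%N = false by lia.
  have -> : (q - t0 = (q - t0.+1).+1)%N by lia.
  by rewrite subr0; ring.
have [e|ne'] := eqVneq q t0.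
  subst q; have [-> _] := @dd_swap_left (t0 - p) p ltac:(lia).
  have -> : (t0.+1 < p)%N = false by lia.
  have -> : (t0.+1 - p = (t0 - p).+1)%N by lia.
  by rewrite !addr0.
rewrite subr0 addr0.
have [h|h] := boolP ((q < t0) || (t0.+1 < p))%N.
  by rewrite (dd_swap_out (d := q - p)) ?addr0 //; lia.
by rewrite dd_swap_mid ?addr0 //; lia.
Qed.

End SwapRow.

(** * Determinants with rows of divided differences *)

Definition ddmx (Fs : nat -> nat -> B) (st : nat -> nat) : 'M[B]_W :=
  \matrix_(i, j) ddrow (Fs i) (st i) j.

Definition upd (T : Type) (f : nat -> T) (i : nat) (x : T) (j : nat) : T :=
  if j == i then x else f j.

Definition elem_mx (c : B) (i j : 'I_W) : 'M[B]_W := 1%:M + c *: delta_mx i j.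

Lemma elem_mulmx c i j (M : 'M[B]_W) i' j' :
  (elem_mx c i j *m M) i' j' = M i' j' + (if i' == i then c * M j j' else 0).
Proof.
rewrite mulmxDl mul1mx mxE -scalemxAl mxE; congr (_ + _).
rewrite mxE (bigD1 j) //= big1 => [|k /negPf hk]; last by rewrite mxE hk andbF mul0r.
by rewrite mxE eqxx andbT addr0; case: ifP => _; rewrite ?mul1r ?mul0r ?mulr0.
Qed.

Lemma mulmx_elem c i j (M : 'M[B]_W) i' j' :
  (M *m elem_mx c i j) i' j' = M i' j' + (if j' == j then c * M i' i else 0).
Proof.
rewrite mulmxDr mulmx1 mxE -scalemxAr mxE; congr (_ + _).
rewrite mxE (bigD1 i) //= big1 => [|k /negPf hk]; last by rewrite mxE hk mulr0.
by rewrite mxE eqxx addr0 /=; case: ifP => _; rewrite ?mulr1 ?mulr0.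
Qed.

Lemma det_elem_mx c (i j : 'I_W) : (j < i)%N -> \det (elem_mx c i j) = 1.
Proof.
move=> hij; rewrite det_trig.
  rewrite big1 // => k _; rewrite !mxE eqxx.
  have -> : (k == i) && (k == j) = false.
    by apply/negP => /andP[/eqP -> /eqP E]; rewrite E ltnn in hij.
  by rewrite mulr0 addr0.
apply/is_trig_mxP => k k' hk; rewrite !mxE.
have -> : (k == k') = false by apply/negP => /eqP E; rewrite E ltnn in hk.
have -> : (k == i) && (k' == j) = false.
  by apply/negP => /andP[/eqP E /eqP E']; rewrite E E' in hk; lia.
by rewrite mulr0 addr0.
Qed.

Section Step.

Variables (Fs : nat -> nat -> B) (st : nat -> nat) (s0 : nat).
Hypothesis Fs_swap : forall i, (i < W)%N -> swapped sB (Fs i).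
Hypothesis st_lt : forall i, (i < W)%N -> (st i < W)%N.
Hypothesis s0_lt : (s0 < W)%N.
Hypothesis st_s0 : st s0 = t0.+1.
Hypothesis st_other : forall i, (i < W)%N -> i <> s0 -> st i = t0.+1 ->
  [/\ i = t0.+1, t0 <> s0, st t0 = t0 & Fs t0 = Fs t0.+1].

Local Notation c := (V t0.+1 - V t0).

(** By [st_other], a row besides [s0] that starts at [t0.+1] lies directly below the row of the same
    function started at [t0], so its correction is a row operation. The correction of row [s0]
    survives and splits off by multilinearity. *)
Lemma det_ddmx_swap :
  sB (\det (ddmx Fs st)) = \det (ddmx Fs st) + c * \det (ddmx Fs (upd st s0 t0)).
Proof.
pose i0 := Ordinal (ltnW ht0); pose i1 := Ordinal ht0; pose o0 := Ordinal s0_lt.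
(* In [N] only row [s0] is corrected; [e] is the coefficient of the row operation correcting row
   [t0.+1], and is 0 when that row starts elsewhere or is [s0] itself. *)
pose N : 'M[B]_W := \matrix_(i, j)
  (ddmx Fs st i j + (if i == o0 then c * ddrow (Fs s0) t0 j else 0)).
pose e := if (st t0.+1 == t0.+1) && (t0.+1 != s0) then c else 0.
have -> : sB (\det (ddmx Fs st)) = \det (elem_mx e i1 i0 *m N *m elem_mx (- c) i1 i0).
  rewrite -det_map_mx; congr (\det _); apply/matrixP => i j.
  rewrite mulmx_elem !elem_mulmx !mxE (ddrow_swap (Fs_swap _)) ?st_lt //=.
  have key (q : 'I_W) : ddrow (Fs i) (st i) q +
      (if st i == t0.+1 then c * ddrow (Fs i) t0 q else 0) =
    ddrow (Fs i) (st i) q + (if i == o0 then c * ddrow (Fs s0) t0 q else 0) +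
    (if i == i1 then e * (ddrow (Fs t0) (st t0) q +
      (if i0 == o0 then c * ddrow (Fs s0) t0 q else 0)) else 0).
    rewrite -addrA; congr (_ + _).
    have [io0|nio] := eqVneq i o0.
      rewrite io0 /= st_s0 eqxx.
      have [E|_] := eqVneq o0 i1; last by rewrite addr0.
      have E' : s0 = t0.+1 by move/(congr1 val): E.
      by rewrite /e -E' eqxx andbF mul0r addr0.
    have nis : (i : nat) <> s0 by move=> E; case/eqP: nio; apply: val_inj.
    have [E|ne] := eqVneq (st i) t0.+1.
      have [E1 E2 E3 E4] := st_other (ltn_ord i) nis E.
      have ec : e = c by rewrite /e -[X in st X]E1 E eqxx -E1 (introN eqP nis).
      have -> : i == i1 by apply/eqP/val_inj.
      have -> : i0 == o0 = false by apply/negP => /eqP /(congr1 val).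
      by rewrite ec add0r addr0 E3 E4 E1.
    rewrite add0r; have [E|//] := eqVneq i i1.
    have -> : e = 0 by rewrite /e; move: ne; rewrite E /= => /negPf ->.
    by rewrite mul0r.
  rewrite key -[t0.+1]/(i1 : nat) key; congr (_ + _).
  have -> : (j == i0) = ((j : nat) == t0) by [].
  by case: ifP => _; rewrite ?oppr0 // mulNr.
rewrite !det_mulmx !det_elem_mx ?mul1r ?mulr1 //.
have -> : \det N = 1 * \det (ddmx Fs st) + c * \det (ddmx Fs (upd st s0 t0)).
  apply: (@determinant_multilinear _ _ _ _ _ o0); apply/matrixP => i j; rewrite !mxE.
  - by rewrite eqxx /upd /= eqxx mul1r.
  - by rewrite eq_sym (negPf (neq_lift _ _)) addr0.
  rewrite eq_sym (negPf (neq_lift _ _)) addr0 /upd.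
  by rewrite -[s0]/(val o0) val_eqE eq_sym (negPf (neq_lift _ _)).
by rewrite mul1r.
Qed.

(** The scalar times [c] is -u_t0, so the operator subtracts u_t0 times the determinant whose row
    [s0] starts at [t0]. Merged into row [s0], this is the right side of [ddrow_leibniz]. *)
Lemma det_ddmx_step : v t0 != 0 ->
  io (1 - v t0.+1 / v t0)^-1 * (sB (\det (ddmx Fs st)) - \det (ddmx Fs st))
    + \det (ddmx Fs st) =
  \det (ddmx (upd Fs s0 (fun t => - V t * Fs s0 t)) (upd st s0 t0)).
Proof.
move=> v0; rewrite det_ddmx_swap addrC [X in _ * (X - _)]addrC addrK mulrA.
have ne : v t0 - v t0.+1 != 0.
  by rewrite subr_eq0; apply/eqP => /v_inj; lia.
have -> : io (1 - v t0.+1 / v t0)^-1 * c = - V t0.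
  by rewrite -rmorphB -rmorphM -rmorphN; congr (io _); field; rewrite ne v0.
pose o0 := Ordinal s0_lt.
rewrite -[X in X + _]mul1r; symmetry.
apply: (@determinant_multilinear _ _ _ _ _ o0); apply/matrixP => i j; rewrite !mxE /upd.
- by rewrite /= eqxx ddrow_leibniz // st_s0 mul1r mulNr.
- by rewrite -[s0]/(val o0) val_eqE eq_sym (negPf (neq_lift _ _)).
by rewrite -[s0]/(val o0) val_eqE eq_sym (negPf (neq_lift _ _)).
Qed.

End Step.
End Swap.
End DividedDifferences.

(** * Complete symmetric polynomials *)

Section CompleteSymmetric.

Variable n : nat.
Implicit Types (x y : Kf n) (xs : seq (Kf n)).

Lemma hcompl0 xs : hcompl 0 xs = 1.
Proof. by elim: xs => //= x xs IH; rewrite big_ord1 expr0 subnn IH mulr1. Qed.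

Lemma hcompl_cons m x xs :
  hcompl m.+1 (x :: xs) = hcompl m.+1 xs + x * hcompl m (x :: xs).
Proof.
rewrite /= big_ord_recl expr0 mul1r subn0 mulr_sumr; congr (_ + _).
by apply: eq_bigr => j _; rewrite lift0 subSS exprS mulrA.
Qed.

(** [hcompl] peels off the first variable; peeling off the last one as well is the only form of
    symmetry used below. *)
Lemma hcompl_rcons m x xs :
  hcompl m.+1 (rcons xs x) = hcompl m.+1 xs + x * hcompl m (rcons xs x).
Proof.
elim: xs m => [|y xs IH] m; first by rewrite hcompl_cons.
rewrite rcons_cons hcompl_cons IH [hcompl _ (y :: xs)]hcompl_cons.
elim: m => [|m IHm]; first by rewrite !hcompl0; ring.
have E1 := hcompl_cons m y (rcons xs x).
have E2 : hcompl m.+1 (y :: rcons xs x) =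
    hcompl m.+1 (y :: xs) + x * hcompl m (y :: rcons xs x).
  by rewrite hcompl_cons IH IHm -hcompl_cons.
have -> : hcompl m.+1 (rcons xs x) =
    hcompl m.+1 (y :: rcons xs x) - y * hcompl m (y :: rcons xs x) by rewrite E1 addrK.
by rewrite E2; ring.
Qed.

(** Expand h_(m+1) of all the variables once at [x] and once at [y], and compare. *)
Lemma hcompl_diff m x y xs :
  hcompl m.+1 (rcons xs y) - hcompl m.+1 (x :: xs) =
  (y - x) * hcompl m (x :: rcons xs y).
Proof.
have h1 := hcompl_cons m x (rcons xs y).
have := hcompl_rcons m y (x :: xs); rewrite rcons_cons h1 => h2.
have -> : hcompl m.+1 (x :: xs) =
  hcompl m.+1 (rcons xs y) + x * hcompl m (x :: rcons xs y) - y * hcompl m (x :: rcons xs y).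
  by rewrite h2 addrK.
ring.
Qed.

(** Induction on [d] through [hcompl_diff]. The base -u contributes (-1)^k and [dd] contributes
    (-1)^d. The nodes are reversed to match the descending indices in [dset]. *)
Lemma dd_exp (B : comNzRingType) (io : {rmorphism Kf n -> B}) (v : nat -> Kf n) (W : nat)
    (v_inj : forall s t, (s < W)%N -> (t < W)%N -> v s = v t -> s = t) (k p d : nat) :
  (p + d < W)%N ->
  dd io v (fun t => io ((- v t) ^+ k)) p d =
  io (if (d <= k)%N then
        (-1) ^+ (k - d) * hcompl (k - d) [seq v t | t <- rev (iota p d.+1)] else 0).
Proof.
elim: d p => [|d IH] p hp.
  rewrite leq0n subn0 [dd _ _ _ _ _]/= [map _ _]/= [in LHS]exprNn.
  congr (io _); congr (_ * _).
  by elim: k => [|k IHk]; rewrite ?hcompl0 // hcompl_cons add0r -IHk exprS.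
have hne : v (p + d.+1)%N - v p != 0.
  by rewrite subr_eq0; apply/eqP => /v_inj; lia.
rewrite /= !IH; try lia.
rewrite -rmorphB -rmorphM; congr (io _).
have [lt_dk|lt_kd|->] := ltngtP d k; last 2 first.
- by rewrite subr0 mulr0.
- by rewrite subnn !hcompl0 subrr mulr0.
have [m ->] : exists m, k = (d + m.+1)%N by exists (k - d).-1; lia.
have -> : (d + m.+1 - d.+1 = m)%N by lia.
rewrite addKn -mulrBr.
set L := [seq v t | t <- rev (iota p.+1 d)].
have iotaSr s e : rev (iota s e.+1) = (s + e)%N :: rev (iota s e).
  by rewrite -[e.+1]addn1 iotaD rev_cat.
have -> : [seq v t | t <- rev (iota p d.+1)] = rcons L (v p).
  by rewrite -map_rcons -rev_cons.
have -> : [seq v t | t <- rev (iota p.+1 d.+1)] = v (p + d.+1)%N :: L.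
  by rewrite iotaSr addSnnS.
have -> : [seq v t | t <- rev (iota p d.+2)] = v (p + d.+1)%N :: rcons L (v p).
  by rewrite iotaSr -map_rcons -rev_cons.
rewrite hcompl_diff exprS.
have E (F : fieldType) (a b e h : F) : a - b != 0 -> (a - b)^-1 * (-1 * e * ((b - a) * h)) = e * h.
  by move=> ?; field.
exact: E.
Qed.

End CompleteSymmetric.

(** * Truncated power series *)

Section CongruenceModDegree.

Variables (K : fieldType) (N D : nat).
Implicit Types p q : {mpoly K[N]}.

(** Congruence modulo degrees above [D]. Being compatible with the ring operations, it stands in for
    [trunc] in all computations. *)
Definition eqt p q := forall m, (mdeg m <= D)%N -> p@_m = q@_m.

Lemma eqt_refl p : eqt p p.
Proof. by []. Qed.

Lemma eqt_trans p q r : eqt p q -> eqt q r -> eqt p r.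
Proof. by move=> h h' m hm; rewrite h ?h'. Qed.

Lemma eqtD p p' q q' : eqt p p' -> eqt q q' -> eqt (p + q) (p' + q').
Proof. by move=> hp hq m hm; rewrite !mcoeffD hp ?hq. Qed.

Lemma eqtB p p' q q' : eqt p p' -> eqt q q' -> eqt (p - q) (p' - q').
Proof. by move=> hp hq m hm; rewrite !mcoeffB hp ?hq. Qed.

Lemma eqtZ c p q : eqt p q -> eqt (c *: p) (c *: q).
Proof. by move=> h m hm; rewrite !mcoeffZ h. Qed.

Lemma eqtM p p' q q' : eqt p p' -> eqt q q' -> eqt (p * q) (p' * q').
Proof.
move=> hp hq m hm; rewrite !mcoeffM.
apply: eq_bigr => -[k1 k2] /= /eqP /(congr1 mdeg); rewrite mdegD => E.
by rewrite hp ?hq //; lia.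
Qed.

Lemma eqt_map (f : {rmorphism K -> K}) p q :
  eqt p q -> eqt (map_mpoly f p) (map_mpoly f q).
Proof. by move=> h m hm; rewrite !mcoeff_map_mpoly h. Qed.

Lemma eqt_geometric b p :
  (forall m, (mdeg m <= D)%N -> p@_m = b ^+ mdeg m) ->
  eqt (p * \prod_(j < N) (1 - b *: 'X_j)) 1.
Proof.
move=> hp.
(* After multiplication by the first [k] factors, only the monomials free of the first [k] variables
   are left. *)
suff H k : (k <= N)%N -> forall m, (mdeg m <= D)%N ->
    (p * \prod_(j < N | (j < k)%N) (1 - b *: 'X_j))@_m =
    if [forall j : 'I_N, (j < k)%N ==> (m j == 0%N)] then b ^+ mdeg m else 0.
  move=> m hm.
  have -> : \prod_(j < N) (1 - b *: 'X_j : {mpoly K[N]}) =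
      \prod_(j < N | (j < N)%N) (1 - b *: 'X_j).
    by apply: eq_bigl => j; rewrite ltn_ord.
  rewrite H // mcoeff1 -mdeg_eq0; case: ifPn => [/forallP h|/forallPn[j]].
    have -> : m = 0%MM.
      by apply/mnmP => j; move: (h j); rewrite ltn_ord /= mnm0E => /eqP.
    by rewrite mdeg0 eqxx expr0.
  rewrite ltn_ord /= => hj; case: eqP => // /eqP; rewrite mdeg_eq0 => /eqP E.
  by rewrite E mnm0E in hj.
elim: k => [|k IH] hk m hm.
  rewrite big_pred0 => [|j]; last by rewrite ltn0.
  rewrite mulr1 hp // ifT //; exact/forallP.
pose o := Ordinal hk.
have {}IH := IH (ltnW hk).
rewrite (bigD1 o) ?ltnSn //= [X in _ * (_ * X)](eq_bigl (fun j : 'I_N => (j < k)%N)); last first.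
  by move=> j; rewrite -val_eqE /= ltnS ltn_neqAle andbC.
rewrite mulrCA; set P := p * _.
rewrite mulrBl mul1r mcoeffB -scalerAl mcoeffZ IH //.
have [m0|m0] := eqVneq (m o) 0%N.
  have -> : ('X_o * P)@_m = 0.
    rewrite mcoeffM big1 // => -[k1 k2] /= /eqP E; rewrite mcoeffX.
    case: eqP => [E'|_]; last by rewrite mul0r.
    by have /= := congr1 (fun m' : 'X_{1..N} => m' o) E; rewrite -E' mnmDE mnm1E eqxx m0.
  rewrite mulr0 subr0; congr (if _ then _ else _); apply: eq_forallb => j.
  rewrite ltnS [in RHS]leq_eqVlt; have [E|//] := eqVneq (j : nat) k.
  have -> : j = o by apply: val_inj; rewrite /= E.
  by rewrite m0 eqxx implybT.
have hU : (U_(o) <= m)%MM.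
  by apply/mnm_lepP => j; rewrite mnm1E; case: eqP => // <-; rewrite lt0n.
have -> : ('X_o * P)@_m = P@_(m - U_(o)) by rewrite mulrC -{1}(submK hU) addmC mcoeffMX.
rewrite IH; last first.
  by apply: leq_trans hm; rewrite -{2}(submK hU) mdegD leq_addr.
have -> : [forall j : 'I_N, (j < k)%N ==> ((m - U_(o))%MM j == 0%N)] =
          [forall j : 'I_N, (j < k)%N ==> (m j == 0%N)].
  apply: eq_forallb => j; case: ltnP => //= hj; rewrite mnmBE mnm1E.
  by have -> : o == j = false by [rewrite -val_eqE /=; lia]; rewrite subn0.
have -> : mdeg m = (mdeg (m - U_(o))%MM).+1.
  by rewrite -{1}(submK hU) mdegD mdeg1 addn1.
have -> : [forall j : 'I_N, (j < k.+1)%N ==> (m j == 0%N)] = false.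
  by apply/negP => /forallP /(_ o); rewrite ltnSn /= (negPf m0).
by case: ifP => _; rewrite ?mulr0 ?subrr // exprS subrr.
Qed.


End CongruenceModDegree.

Section Truncation.

Variables (n N D : nat).
Local Notation A := {mpoly (Kf n)[N]}.
Implicit Types p q : A.

Lemma mcoeff_trunc p m : (trunc D p)@_m = if (mdeg m <= D)%N then p@_m else 0.
Proof.
rewrite /trunc raddf_sum /= -big_filter.
have [mp|mp] := boolP (m \in [seq i <- msupp p | (mdeg i <= D)%N]).
  rewrite (bigD1_seq m) ?filter_uniq ?msupp_uniq //= mcoeffZ mcoeffX eqxx mulr1.
  rewrite big1 => [|i /negPf hi]; last by rewrite mcoeffZ mcoeffX hi mulr0.
  by move: mp; rewrite mem_filter => /andP[-> _]; rewrite addr0.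
rewrite big_seq big1 => [|i hi]; last first.
  rewrite mcoeffZ mcoeffX; case: eqP => [E|_]; last by rewrite mulr0.
  by rewrite E (negPf mp) in hi.
move: mp; rewrite mem_filter negb_and; case: leqP => //= _.
by move/memN_msupp_eq0 => ->.
Qed.

Lemma cmapE (f : {rmorphism Kf n -> Kf n}) p : cmap f p = map_mpoly f p.
Proof.
apply/mpolyP => m; rewrite mcoeff_map_mpoly /cmap raddf_sum /=.
have [mp|mp] := boolP (m \in msupp p).
  rewrite (bigD1_seq m) ?msupp_uniq //= mcoeffZ mcoeffX eqxx mulr1.
  by rewrite big1 ?addr0 // => i /negPf hi; rewrite mcoeffZ mcoeffX hi mulr0.
rewrite (memN_msupp_eq0 mp) rmorph0 big_seq big1 // => i hi.
rewrite mcoeffZ mcoeffX; case: eqP => [E|_]; last by rewrite mulr0.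
by rewrite E (negPf mp) in hi.
Qed.

Lemma eq_cmap (f g : Kf n -> Kf n) : f =1 g -> @cmap n N f =1 cmap g.
Proof. by move=> h p; apply: eq_bigr => m _; rewrite h. Qed.

Lemma trunc_eqt p q : eqt D p q <-> trunc D p = trunc D q.
Proof.
split=> [h|h m hm].
  by apply/mpolyP => m; rewrite !mcoeff_trunc; case: ifP => // /h.
by move/(congr1 (mcoeff m)): h; rewrite !mcoeff_trunc hm.
Qed.

Lemma eqt_trunc p : eqt D (trunc D p) p.
Proof. by move=> m hm; rewrite mcoeff_trunc hm. Qed.

Lemma mcoeff_Omega (b : Kf n) m :
  (Omega N D b)@_m = if (mdeg m <= D)%N then b ^+ mdeg m else 0.
Proof.
have hs d : (hsym n N d)@_m = (mdeg m == d)%:R.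
  rewrite /hsym raddf_sum /=.
  have [E|ne] := eqVneq (mdeg m) d; last first.
    rewrite big1 // => i /eqP E; rewrite mcoeffX; case: eqP => // E'.
    by rewrite -E' E eqxx in ne.
  have hm : (mdeg m < d.+1)%N by rewrite E.
  rewrite (bigD1 (BMultinom hm)) /= ?E // mcoeffX eqxx big1 ?addr0 // => i /andP[_ hi].
  by rewrite mcoeffX -[m]/(val (BMultinom hm)) val_eqE (negPf hi).
rewrite /Omega raddf_sum /=.
under eq_bigr do rewrite mcoeffZ hs.
case: leqP => h.
  rewrite (bigD1 (Ordinal (h : (mdeg m < D.+1)%N))) //= eqxx mulr1 big1 ?addr0 // => i hi.
  by move: hi; rewrite -val_eqE /= eq_sym => /negPf ->; rewrite mulr0.
by rewrite big1 // => i _; case: eqP => E; rewrite ?mulr0 //; have := ltn_ord i; lia.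
Qed.

Lemma cmap_Omega (f : {rmorphism Kf n -> Kf n}) (b : Kf n) :
  cmap f (Omega N D b) = Omega N D (f b).
Proof.
apply/mpolyP => m; rewrite cmapE mcoeff_map_mpoly !mcoeff_Omega.
by case: ifP => _; [apply: rmorphXn | apply: rmorph0].
Qed.

Lemma Omega_invK (b : Kf n) : eqt D (Omega N D b * Omega_inv N b) 1.
Proof. by apply: eqt_geometric => m hm; rewrite mcoeff_Omega hm. Qed.

End Truncation.

(** * Automorphisms of the coefficient field *)

Lemma frac_numden (R : idomainType) (x : {fraction R}) :
  x = tofrac \n_(repr x) / tofrac \d_(repr x).
Proof.
have hd : tofrac \d_(repr x) != 0 by rewrite tofrac_eq0 denom_ratioP.
apply: (mulIf hd); rewrite divfK // -{1}[x]reprK; unlock FracField.tofrac.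
rewrite -[LHS]FracField.pi_mul; apply/eqmodP; rewrite /= FracField.equivfE /FracField.mulf.
by rewrite !numden_Ratio ?(mulf_neq0, oner_neq0, denom_ratioP) // !mulr1 mulrC.
Qed.

Section FractionExtension.

Variables (R : idomainType) (F : fieldType) (phi : {rmorphism R -> F}).
Hypothesis phi_inj : forall p, phi p = 0 -> p = 0.

(** This has the shape of [act], which works on the representative picked by [repr]; injectivity of
    [phi] makes that choice irrelevant. *)
Definition frac_ext (x : {fraction R}) : F := phi \n_(repr x) / phi \d_(repr x).

Lemma phi_neq0 p : p != 0 -> phi p != 0.
Proof. by apply: contra => /eqP /phi_inj ->. Qed.

Lemma frac_ext_div p q : q != 0 -> frac_ext (tofrac p / tofrac q) = phi p / phi q.
Proof.
move=> q0; set x := tofrac p / tofrac q; rewrite /frac_ext.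
have d0 : \d_(repr x) != 0 by apply: denom_ratioP.
apply/eqP; rewrite eqr_div ?phi_neq0 // -!rmorphM; apply/eqP; congr (phi _).
apply/eqP; rewrite -tofrac_eq !rmorphM -eqr_div ?tofrac_eq0 //.
by rewrite -frac_numden.
Qed.

Lemma frac_extE p : frac_ext (tofrac p) = phi p.
Proof.
by rewrite -[tofrac p]divr1 -tofrac1 frac_ext_div ?oner_neq0 // rmorph1 divr1.
Qed.

Lemma frac_ext_zmod_morphism : zmod_morphism frac_ext.
Proof.
move=> x y; rewrite [x]frac_numden [y]frac_numden.
move: (denom_ratioP (repr x)) (denom_ratioP (repr y)).
move: \n_(repr x) \n_(repr y) \d_(repr x) \d_(repr y) => a c b d b0 d0.
have subf_div (E : fieldType) (a' b' c' d' : E) : b' != 0 -> d' != 0 ->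
    a' / b' - c' / d' = (a' * d' - c' * b') / (b' * d').
  by move=> hb hd; field; rewrite hb hd.
rewrite (subf_div {fraction R}) ?tofrac_eq0 // -!rmorphM -rmorphB.
by rewrite !frac_ext_div ?mulf_neq0 // subf_div ?phi_neq0 // -!rmorphM -rmorphB.
Qed.

Lemma frac_ext_monoid_morphism : monoid_morphism frac_ext.
Proof.
split=> [|x y]; first by rewrite -tofrac1 frac_extE rmorph1.
rewrite [x]frac_numden [y]frac_numden.
move: (denom_ratioP (repr x)) (denom_ratioP (repr y)).
move: \n_(repr x) \n_(repr y) \d_(repr x) \d_(repr y) => a c b d b0 d0.
by rewrite mulf_div -!rmorphM !frac_ext_div ?mulf_neq0 // mulf_div -!rmorphM.
Qed.

Lemma frac_ext_rmorphism : exists f : {rmorphism {fraction R} -> F}, f =1 frac_ext.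
Proof.
pose m1 := GRing.isZmodMorphism.Build _ _ frac_ext frac_ext_zmod_morphism.
pose m2 := GRing.isMonoidMorphism.Build _ _ frac_ext frac_ext_monoid_morphism.
pose f : {rmorphism {fraction R} -> F} := HB.pack frac_ext m1 m2.
by exists f.
Qed.

End FractionExtension.

(* Clears the denominators coming from e^(a_n) = (e^(a_1) ... e^(a_(n-1)))^-1, so that
   the injectivity of a substitution can be read off the exponents. *)
Lemma perm_monomial (F : fieldType) (k : nat) (x : nat -> F) (pi M : nat -> nat) (d : nat) :
  (forall j, x j != 0) -> x k = (\prod_(j < k) x j)^-1 ->
  (forall i, pi (pi i) = i) -> (forall i, (i < k.+1)%N -> (pi i < k.+1)%N) ->
  M k = 0%N -> (M (pi k) <= d)%N ->
  (\prod_(j < k) x j) ^+ d * \prod_(j < k) x (pi j) ^+ M j =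
  \prod_(j < k) x j ^+ (d + M (pi j) - M (pi k)).
Proof.
move=> x0 xk piK pi_lt Mk Md.
have -> : \prod_(j < k) x (pi j) ^+ M j = \prod_(j < k.+1) x (pi j) ^+ M j.
  by rewrite big_ord_recr /= Mk expr0 mulr1.
pose pio (j : 'I_k.+1) : 'I_k.+1 := Ordinal (pi_lt j (ltn_ord j)).
have pioK : involutive pio by move=> j; apply: val_inj; rewrite /= piK.
rewrite (reindex_inj (inv_inj pioK)) /=.
rewrite (eq_bigr (fun j : 'I_k.+1 => x j ^+ M (pi j))); last by move=> j _ /=; rewrite piK.
rewrite big_ord_recr /= xk exprVn.
rewrite -[X in _ ^+ X * _](subnK Md) exprD mulrCA mulfK; last first.
  by rewrite expf_neq0 //; apply/prodf_neq0.
rewrite mulrC -prodrXl -big_split /=; apply: eq_bigr => j _.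
by rewrite -exprD; congr (_ ^+ _); lia.
Qed.

(** * Involutions of the n variables with product 1 *)

Section IndexSwap.

Variable k : nat.
Local Notation n := k.+1.
Local Notation P := (\prod_(j < k) xv n j).

Lemma xv_lt (j : 'I_k) : xv n j = tofrac 'X_j.
Proof. by rewrite /xv valK. Qed.

Lemma xv_neq0 i : xv n i != 0.
Proof.
have X0 (j : 'I_k) : tofrac ('X_j : {mpoly int[k]}) != 0.
  by rewrite tofrac_eq0 -msupp_eq0 msuppX.
rewrite /xv; case: insubP => [j _ _|_]; first exact: X0.
by rewrite invr_eq0; apply/prodf_neq0 => j _; apply: X0.
Qed.

Lemma xv_last : xv n k = P^-1.
Proof.
rewrite {1}/xv insubF ?ltnn //; congr (_^-1).
by rewrite (eq_bigr _ (fun j _ => xv_lt j)).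
Qed.

Lemma prod_xv_neq0 : P != 0.
Proof. by apply/prodf_neq0 => j _; apply: xv_neq0. Qed.

(* Exponents extended by 0 at the last, dependent, variable. *)
Definition expo (m : 'X_{1..k}) (i : nat) : nat :=
  if insub i : option 'I_k is Some j then m j else 0%N.

Lemma expo_lt m (j : 'I_k) : expo m j = m j.
Proof. by rewrite /expo valK. Qed.

Lemma expo_last m : expo m k = 0%N.
Proof. by rewrite /expo insubF //= ltnn. Qed.

Lemma expo_le m i : (expo m i <= mdeg m)%N.
Proof.
rewrite /expo; case: insub => [j|//].
by rewrite mdegE (bigD1 j) //= leq_addr.
Qed.

Variable pi : nat -> nat.
Hypothesis piK : forall i, pi (pi i) = i.
Hypothesis pi_lt : forall i, (i < n)%N -> (pi i < n)%N.

(** After the permutation the dependent variable has exponent [expo m (pi k)]. As it equals the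
    inverse of P, this exponent is subtracted everywhere; the shift by [d] keeps the result
    nonnegative. *)
Definition mono_img d m : 'X_{1..k} := [multinom (d + expo m (pi j) - expo m (pi k))%N | j < k].

(** The image determines the extended exponents up to a common shift, and the exponent 0 at the last
    variable fixes the shift. *)
Lemma mono_img_inj d m m' : (mdeg m <= d)%N -> (mdeg m' <= d)%N ->
  mono_img d m = mono_img d m' -> m = m'.
Proof.
move=> hm hm' /mnmP E.
have E' i : (i < n)%N -> (expo m (pi i) + expo m' (pi k) = expo m' (pi i) + expo m (pi k))%N.
  rewrite ltnS leq_eqVlt => /orP[/eqP ->|hi]; first by rewrite addnC.
  have := E (Ordinal hi); rewrite !mnmE /=.
  have := expo_le m (pi k); have := expo_le m' (pi k); lia.
have := E' (pi k) (pi_lt (ltnSn k)); rewrite piK !expo_last => E0.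
apply/mnmP => j; rewrite -!expo_lt.
have := E' (pi j) (pi_lt (ltnW (ltn_ord j : (j < k)%N))); rewrite piK; lia.
Qed.

Lemma mono_imgE d m : (mdeg m <= d)%N ->
  P ^+ d * mmap1 (fun j : 'I_k => xv n (pi j)) m = tofrac 'X_[mono_img d m].
Proof.
move=> hm.
have -> : mmap1 (fun j : 'I_k => xv n (pi j)) m = \prod_(j < k) xv n (pi j) ^+ expo m j.
  by rewrite /mmap1; apply: eq_bigr => j _; rewrite expo_lt.
rewrite perm_monomial ?expo_last //; first last.
- exact: leq_trans (expo_le m _) hm.
- exact: xv_last.
- exact: xv_neq0.
rewrite [in RHS]mpolyXE_id rmorph_prod /=.
by apply: eq_bigr => j _; rewrite tofracXn mnmE -xv_lt.
Qed.

Definition subst_morph : {rmorphism {mpoly int[k]} -> Kf n} :=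
  mmap (intmul 1 : {rmorphism int -> Kf n}) (fun j : 'I_k => xv n (pi j)).

Lemma subst_morph_term d c m : (mdeg m <= d)%N ->
  P ^+ d * subst_morph (c *: 'X_[m]) = tofrac (c *: 'X_[mono_img d m]).
Proof.
move=> hm; rewrite -!mul_mpolyC !rmorphM mulrCA; congr (_ * _).
  by rewrite -[c]intz !rmorph_int.
by apply: etrans (mono_imgE hm); congr (_ * _); apply: mmapX.
Qed.

(** Once multiplied by P^d, distinct monomials of [p] have distinct monomials as images, so nothing
    cancels. *)
Lemma subst_inj (p : {mpoly int[k]}) : subst_morph p = 0 -> p = 0.
Proof.
move=> h0; apply/eqP; rewrite -msupp_eq0.
pose d := msize p.
have hd m : m \in msupp p -> (mdeg m <= d)%N by move=> /msize_mdeg_lt /ltnW.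
pose q : {mpoly int[k]} := \sum_(m <- msupp p) p@_m *: 'X_[mono_img d m].
have q0 : q = 0.
  apply/eqP; rewrite -tofrac_eq0 /q rmorph_sum; apply/eqP.
  transitivity (P ^+ d * subst_morph p); last by rewrite h0 mulr0.
  rewrite [in RHS](mpolyE p) rmorph_sum mulr_sumr.
  by apply: eq_big_seq => m hm; rewrite subst_morph_term ?hd.
case E: (msupp p) => [//|m0 s].
have hm0 : m0 \in msupp p by rewrite E mem_head.
have : q@_(mono_img d m0) = p@_m0.
  rewrite /q raddf_sum /= (bigD1_seq m0) ?msupp_uniq //= mcoeffZ mcoeffX eqxx mulr1.
  rewrite big_seq_cond big1 ?addr0 // => m /andP[hm ne].
  rewrite mcoeffZ mcoeffX; case: eqP => [/mono_img_inj E'|_]; last by rewrite mulr0.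
  by rewrite E' ?eqxx ?hd in ne.
by rewrite q0 mcoeff0 => /esym /eqP; rewrite mcoeff_eq0 hm0.
Qed.

Lemma act_rmorphism : exists f : {rmorphism Kf n -> Kf n},
  f =1 act (n := n) pi /\ forall i, (i < n)%N -> f (xv n i) = xv n (pi i).
Proof.
have [f hf] := frac_ext_rmorphism subst_inj.
exists f; split=> [x|]; first by rewrite hf.
have hX (j : 'I_k) : f (tofrac 'X_j) = xv n (pi j).
  rewrite hf frac_extE; last exact: subst_inj.
  transitivity (mmap1 (fun i : 'I_k => xv n (pi i)) U_(j)%MM); first exact: mmapX.
  rewrite /mmap1 (bigD1 j) //= mnm1E eqxx expr1.
  by rewrite big1 ?mulr1 // => i; rewrite mnm1E eq_sym => /negPf ->.
move=> i; rewrite ltnS leq_eqVlt => /orP[/eqP ->|hi]; last first.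
  by rewrite -[i]/(nat_of_ord (Ordinal hi)) xv_lt hX.
rewrite xv_last fmorphV rmorph_prod /=.
rewrite (eq_bigr (fun j : 'I_k => xv n (pi j))); last by move=> j _; rewrite xv_lt hX.
pose pio (j : 'I_n) : 'I_n := Ordinal (pi_lt (ltn_ord j)).
have pioK : involutive pio by move=> j; apply: val_inj; rewrite /= piK.
(* The image of the dependent variable is found from the relation that all n variables multiply to
   1, which the permutation preserves. *)
have all1 : \prod_(j < n) xv n j = 1.
  by rewrite big_ord_recr /= xv_last divff ?prod_xv_neq0.
rewrite (reindex_inj (inv_inj pioK)) big_ord_recr /= in all1.
have Q0 : \prod_(j < k) xv n (pi j) != 0 by apply/prodf_neq0 => j _; apply: xv_neq0.
by apply: (mulfI Q0); rewrite divff.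
Qed.

End IndexSwap.

Lemma swapnK i j : involutive (swapn i j).
Proof.
move=> x; rewrite /swapn; have [->|xi] := eqVneq x i.
  by case: eqP => [->//|_]; rewrite eqxx.
by have [->|xj] := eqVneq x j; rewrite ?eqxx // (negPf xi) (negPf xj).
Qed.

Lemma swapn_lt n i j x : (i < n)%N -> (j < n)%N -> (x < n)%N -> (swapn i j x < n)%N.
Proof. by rewrite /swapn; case: eqP => // _; case: eqP. Qed.

Lemma act_swap_rmorphism n i j : (i < n)%N -> (j < n)%N ->
  exists f : {rmorphism Kf n -> Kf n},
    f =1 act (n := n) (swapn i j) /\
    forall x, (x < n)%N -> f (xv n x) = xv n (swapn i j x).
Proof.
case: n => // k hi hj; apply: act_rmorphism; first exact: swapnK.
by move=> x; apply: swapn_lt.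
Qed.

Lemma xv_inj n i j : (1 < n)%N -> (i < n)%N -> (j < n)%N -> xv n i = xv n j -> i = j.
Proof.
case: n => // k hk.
have inj_lt (x y : 'I_k) : xv k.+1 x = xv k.+1 y -> x = y :> nat.
  rewrite !xv_lt => /eqP; rewrite tofrac_eq => /eqP /(congr1 (mcoeff U_(x)%MM)).
  rewrite !mcoeffX eqxx; case: (eqVneq U_(y)%MM U_(x)%MM) => [+ _|_ /eqP].
    by move=> /(congr1 (fun m : 'X_{1..k} => m x)); rewrite !mnm1E eqxx; case: eqP => // ->.
  by rewrite oner_eq0.
have ne_last (x : 'I_k) : xv k.+1 x <> xv k.+1 k.
  (* An identity between polynomials that fails when all variables are set to 0. *)
  move=> E; have : xv k.+1 x * \prod_(j < k) xv k.+1 j = 1.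
    by rewrite E xv_last mulVf // prod_xv_neq0.
  rewrite (eq_bigr _ (fun j _ => xv_lt j)) xv_lt -rmorph_prod -rmorphM => /eqP.
  rewrite -tofrac1 tofrac_eq => /eqP /(congr1 (meval (fun=> 0 : int))).
  by rewrite rmorphM /= mevalXU mul0r rmorph1.
rewrite !ltnS => hi hj; have [hi'|hi'] := ltnP i k; have [hj'|hj'] := ltnP j k.
- by move=> E; apply: (inj_lt (Ordinal hi') (Ordinal hj')).
- have -> : j = k by lia.
  by move=> E; case: (ne_last (Ordinal hi')).
- have -> : i = k by lia.
  by move=> /esym E; case: (ne_last (Ordinal hj')).
by lia.
Qed.

Lemma xv_neq0_lt n i : (i < n)%N -> xv n i != 0.
Proof. by case: n => // k _; apply: xv_neq0. Qed.

Lemma eaE n (p : int) (k c : nat) : p + c%:Z * n%:Z = k.+1%:Z -> ea n p = xv n (k %% n).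
Proof.
move=> E; rewrite /ea; congr (xv n _).
have -> : ((p - 1) %% n)%Z = (k%:Z %% n)%Z.
  by rewrite -(modzMDl c%:Z (p - 1)); congr (_ %% _)%Z; lia.
by rewrite modz_nat.
Qed.

(** Treats s_theta and the s_i alike: each exchanges the cyclic neighbours i - 1 and i modulo n,
    counted from 0. *)
Lemma s_coef_rmorphism n i : (1 < n)%N -> (i < n)%N ->
  exists f : {rmorphism Kf n -> Kf n},
   [/\ f =1 (if i == 0%N then @stheta_coef n else @s_coef n i),
       f (xv n ((i + n.-1) %% n)) = xv n i, f (xv n i) = xv n ((i + n.-1) %% n) &
       forall x, (x < n)%N -> x <> i -> x <> ((i + n.-1) %% n)%N -> f (xv n x) = xv n x].
Proof.
move=> hn hi; have [->|i0] := eqVneq i 0%N.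
  have [f [h1 h2]] := @act_swap_rmorphism n 0 n.-1 ltac:(lia) ltac:(lia).
  exists f; rewrite add0n modn_small; last by lia.
  rewrite !h2 /swapn; try lia; split=> //.
  - have -> : (n.-1 == 0%N) = false by lia.
    by rewrite eqxx.
  - move=> x hx n0 n1; rewrite h2 // /swapn.
    by move/eqP/negPf: n0 => ->; move/eqP/negPf: n1 => ->.
have [f [h1 h2]] := @act_swap_rmorphism n i.-1 i ltac:(lia) hi.
have -> : ((i + n.-1) %% n = i.-1)%N.
  have -> : (i + n.-1 = i.-1 + n)%N by lia.
  by rewrite modnDr modn_small //; lia.
exists f; rewrite !h2 /swapn; try lia; split=> //.
- by rewrite eqxx.
- have -> : (i == i.-1) = false by lia.
  by rewrite eqxx.
- move=> x hx n0 n1; rewrite h2 // /swapn.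
  by move/eqP/negPf: n0 => ->; move/eqP/negPf: n1 => ->.
Qed.

(** * Building sequences *)

Definition height (w : seq (nat * nat)) (s : nat) : nat := count (fun b => b.2 == s) w.

(** The boxes form a Young diagram, described through its column heights. *)
Definition stacked (w : seq (nat * nat)) : Prop :=
  (forall r s, ((r, s) \in w) = (0 < r <= height w s)%N) /\
  (forall s, (0 < s)%N -> (height w s.+1 <= height w s)%N).

Lemma height_rcons w b s : height (rcons w b) s = (height w s + (b.2 == s))%N.
Proof. by rewrite /height -cats1 count_cat /= addn0. Qed.

Lemma stacked_nil : stacked [::].
Proof. by split=> [r s|//]; rewrite in_nil /height /=; lia. Qed.

Lemma stacked_antitone w s s' : stacked w -> (0 < s <= s')%N -> (height w s' <= height w s)%N.
Proof.
move=> [_ hw] /andP[s0]; elim: s' => [|s' IH]; first by lia.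
rewrite leq_eqVlt => /orP[/eqP ->//|]; rewrite ltnS => hs.
by apply: leq_trans (IH hs); apply: hw; lia.
Qed.

Section AddBox.

Variables (w : seq (nat * nat)) (r s : nat).
Hypothesis w_st : stacked w.
Hypothesis fresh_box : (r, s) \notin w.
Hypothesis r_gt0 : (0 < r)%N.
Hypothesis above : (1 < r)%N ==> ((r.-1, s) \in w).

Lemma new_box_row : r = (height w s).+1.
Proof.
have [hm _] := w_st.
by move: fresh_box above; rewrite !hm; lia.
Qed.

Hypothesis left_of : (1 < s)%N ==> ((r, s.-1) \in w).

Lemma stacked_rcons : stacked (rcons w (r, s)).
Proof.
have [hm ha] := w_st; have hr := new_box_row.
split=> [r' s'|s' s'0].
  rewrite mem_rcons inE hm height_rcons /= xpair_eqE.
  rewrite [s' == s]eq_sym; have [E|_] := eqVneq s s'; last by rewrite andbF; lia.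
  by rewrite -E andbT; lia.
rewrite !height_rcons /=; have := ha s' s'0.
have [E|_] := eqVneq s s'.+1; last by lia.
by move: left_of; rewrite hm E /=; move: hr; rewrite E; lia.
Qed.

End AddBox.

Lemma lt_conj_part la r s : is_partition la -> (0 < s)%N ->
  (s <= nth 0 la r)%N = (r < conj_part la s)%N.
Proof.
rewrite /is_partition /conj_part => /andP[+ _] s0.
elim: la r => [|x la IH] r /=; first by rewrite nth_nil; lia.
move=> hp; have hla := path_sorted hp.
have hmin : (x < s)%N -> count (fun y => s <= y)%N la = 0%N.
  move=> hx; apply/eqP; rewrite -leqn0 leqNgt -has_count; apply/hasPn => y hy.
  have tr : transitive geq by move=> a b c /= h1 h2; apply: leq_trans h2 h1.
  by have /allP /(_ _ hy) /= := order_path_min tr hp; lia.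
case: r => [|r] /=; first by case: (leqP s x) => h; [|rewrite hmin //]; lia.
by rewrite IH //; case: (leqP s x) => h; [|rewrite hmin //]; lia.
Qed.

Lemma in_diagramE la r s : is_partition la -> (0 < s)%N ->
  in_diagram la (r, s) = (0 < r <= conj_part la s)%N.
Proof.
move=> hp s0; rewrite /in_diagram /= s0; case: r => [//|r] /=.
rewrite lt_conj_part // andbC; case: (ltnP r (conj_part la s)) => //= h.
exact: leq_trans h (count_size _ _).
Qed.

Lemma in_diagram_size la r s : is_partition la -> in_diagram la (r, s) ->
  [&& 0 < r, r <= size la, 0 < s & s <= head 0 la]%N.
Proof.
move=> hp h; have /and4P[/= r0 hr s0 _] := h.
rewrite r0 hr s0 -nth0 lt_conj_part //=.
by move: h; rewrite in_diagramE //; lia.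
Qed.

Section BuildingSequence.

Variables (la : seq nat) (w : seq (nat * nat)).
Hypothesis la_part : is_partition la.
Hypothesis w_build : building_seq la w.

Lemma building_uniq : uniq w. Proof. by case/and4P: w_build. Qed.

Lemma building_in_diagram b : b \in w -> in_diagram la b.
Proof. by case/and4P: w_build => _ /allP h _ _; apply: h. Qed.

Lemma stacked_take k : (k <= size w)%N -> stacked (take k w).
Proof.
elim: k => [|k IH] hk; first by rewrite take0; apply: stacked_nil.
rewrite (take_nth (0, 0)%N) //; have {}IH := IH (ltnW hk).
have /and4P[_ _ _ /allP /(_ k)] := w_build.
rewrite mem_iota /= add0n hk => /(_ isT).
have hin := building_in_diagram (mem_nth (0, 0)%N hk).
have hnew : nth (0, 0)%N w k \notin take k w.
  have := building_uniq; rewrite -[X in uniq X](cat_take_drop k) cat_uniq => /and3P[_ /hasPn h _].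
  by apply: h; rewrite (drop_nth (0, 0)%N) // mem_head.
move: hin hnew; case: (nth _ _ _) => r s hin hnew /= /andP[h1 h2].
by apply: stacked_rcons => //; case/and4P: hin.
Qed.

Lemma building_step k : (k < size w)%N ->
  let b := nth (0, 0)%N w k in
  [/\ take k.+1 w = rcons (take k w) b, in_diagram la b & b.1 = (height (take k w) b.2).+1].
Proof.
move=> hk b; split; first exact: take_nth.
  exact/building_in_diagram/mem_nth.
have hnew : b \notin take k w.
  have := building_uniq; rewrite -[X in uniq X](cat_take_drop k) cat_uniq => /and3P[_ /hasPn h _].
  by apply: h; rewrite (drop_nth (0, 0)%N) // mem_head.
have /and4P[_ _ _ /allP /(_ k)] := w_build.
rewrite mem_iota /= add0n hk -/b => /(_ isT) /andP[h1 _].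
have := building_in_diagram (mem_nth (0, 0)%N hk); rewrite -/b => /and4P[h0 _ _ _].
by apply: (new_box_row (stacked_take (ltnW hk))); rewrite -?surjective_pairing.
Qed.

(** Pigeonhole: [w] has no repetitions, lies in the diagram and has as many entries as the diagram
    has boxes. *)
Lemma building_mem b : in_diagram la b -> b \in w.
Proof.
pose boxes := [seq (i.+1, j.+1) | i <- iota 0 (size la), j <- iota 0 (nth 0 la i)].
have sub c : in_diagram la c -> c \in boxes.
  case: c => -[|r] [|s]; rewrite /in_diagram ?andbF //= => /andP[hr hs].
  by apply/allpairsPdep; exists r, s; rewrite !mem_iota.
have hsize : size boxes = sumn la.
  rewrite size_allpairs_dep; congr sumn.
  rewrite -[RHS](mkseq_nth 0%N) /mkseq; apply: eq_map => i; exact: size_iota.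
have /and4P[hu _ /eqP hs _] := w_build.
have hle : (size boxes <= size w)%N by rewrite hsize hs.
have [_ E] := uniq_min_size hu (fun c hc => sub c (building_in_diagram hc)) hle.
by move=> /sub; rewrite E.
Qed.

Lemma building_height s : (0 < s)%N -> height w s = conj_part la s.
Proof.
move=> s0; have := stacked_take (leqnn _); rewrite take_size => -[hm _].
have E r : (0 < r <= height w s)%N = (0 < r <= conj_part la s)%N.
  rewrite -hm -in_diagramE //; apply/idP/idP; [exact: building_in_diagram | exact: building_mem].
by have := E (height w s); have := E (conj_part la s); lia.
Qed.

Lemma height_take_le k s : (0 < s)%N -> (height (take k w) s <= conj_part la s)%N.
Proof.
move=> s0; rewrite -building_height // /height -[X in (_ <= count _ X)%N](cat_take_drop k).
by rewrite count_cat leq_addr.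
Qed.

End BuildingSequence.

(** * Adding a box *)

Lemma prod_swap (R : comNzRingType) (F G : nat -> R) (a t : nat) : (t.+1 < a)%N ->
  G t = F t.+1 -> G t.+1 = F t ->
  (forall j, (j < a)%N -> j <> t -> j <> t.+1 -> G j = F j) ->
  \prod_(j < a) G j = \prod_(j < a) F j.
Proof.
move=> ht h0 h1 h2; have ht' := ltnW ht.
rewrite (bigD1 (Ordinal ht')) // (bigD1 (Ordinal ht)) /=; last by rewrite -val_eqE /=; lia.
rewrite [RHS](bigD1 (Ordinal ht')) // [in RHS](bigD1 (Ordinal ht)) /=; last first.
  by rewrite -val_eqE /=; lia.
rewrite h0 h1 mulrCA; congr (_ * (_ * _)).
apply: eq_bigr => j /andP[n0 n1]; move: n0 n1; rewrite -!val_eqE /= => n0 n1.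
by apply: h2 => //; apply/eqP.
Qed.

Section Window.

Variables (n N D a W : nat).
Hypotheses (n_gt1 : (1 < n)%N) (W_le : (W <= n)%N) (a_le : (a <= W)%N).
Local Notation A := {mpoly (Kf n)[N]}.
Local Notation io := (@mpolyC N (Kf n) : {rmorphism Kf n -> A}).

(* Position t of the window carries the paper's index l + t, where l = n - a + 1. *)
Definition win (t : nat) : nat := ((n - a + t) %% n)%N.
Definition vw (t : nat) : Kf n := (xv n (win t))^-1.
Definition Om (t : nat) : A := Omega N D (1 - vw t).

(* Row i >= a is the dagger row s = i - a + 1; the base -u absorbs its signs (-1)^m. *)
Definition rowF (h : nat -> nat) (i : nat) : nat -> A :=
  if (i < a)%N then Om else fun t => io ((- vw t) ^+ h (i - a).+1).
(** A dagger row fills the columns from [i - h s] to [i]: column [i] is the case m = 0, and beyond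
    it the divided differences of u^(h s) vanish. *)
Definition rowst (h : nat -> nat) (i : nat) : nat :=
  if (i < a)%N then i else (i - h (i - a).+1)%N.

Lemma win_lt t : (win t < n)%N.
Proof. by rewrite ltn_mod; lia. Qed.

Lemma win_inj s t : (s < W)%N -> (t < W)%N -> win s = win t -> s = t.
Proof.
by move=> hs ht /eqP; rewrite /win eqn_modDl !modn_small; [move/eqP|lia|lia].
Qed.

Lemma xv_win_inj s t : (s < W)%N -> (t < W)%N -> xv n (win s) = xv n (win t) -> s = t.
Proof. by move=> hs ht /(xv_inj n_gt1 (win_lt s) (win_lt t)); apply: win_inj. Qed.

Lemma vw_inj s t : (s < W)%N -> (t < W)%N -> vw s = vw t -> s = t.
Proof. by move=> hs ht /invr_inj; apply: xv_win_inj. Qed.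

Lemma ea_win (p : int) t : p = (n - a + t).+1%:Z -> ea n p = xv n (win t).
Proof. by move=> ->; rewrite (@eaE _ _ (n - a + t) 0) ?mul0r ?addr0. Qed.

Lemma zzE t d : zz n N D (n - a + t).+1%:Z d = dd io vw Om t d.
Proof.
elim: d t => [|d IH] t.
  by rewrite /= /Om /bb (@ea_win _ t).
rewrite /= -mul_mpolyC IH.
have -> : (n - a + t).+1%:Z + 1 = (n - a + t.+1).+1%:Z by lia.
rewrite IH (@ea_win ((n - a + t).+1%:Z) t) //.
by rewrite (@ea_win ((n - a + t).+1%:Z + d.+1%:Z) (t + d.+1)%N) //; lia.
Qed.

Lemma xiE la : size la = a -> xi n N D la = \prod_(t < a) Om t.
Proof.
move=> ha; rewrite /xi ha (reindex_inj rev_ord_inj) /=.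
apply: eq_bigr => t _; rewrite /Om /bb; congr (Omega _ _ (1 - _^-1)).
have ht := ltn_ord t.
(* The indices 1 - i of [xi] lie one period below those of the window. *)
by rewrite (@eaE _ _ (n - a + t) 1) //; lia.
Qed.

Section Transposition.

Variable t0 : nat.
Hypothesis ht0 : (t0.+1 < W)%N.

Variable f : {rmorphism Kf n -> Kf n}.
Hypothesis f_t0 : f (xv n (win t0)) = xv n (win t0.+1).
Hypothesis f_t1 : f (xv n (win t0.+1)) = xv n (win t0).
Hypothesis f_other : forall x, (x < n)%N -> x <> win t0.+1 -> x <> win t0 ->
  f (xv n x) = xv n x.

Local Notation fA := (map_mpoly f : {rmorphism A -> A}).

Lemma vw_swapped : swapped W t0 f vw.
Proof.
split.
- by rewrite /vw fmorphV f_t0.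
- by rewrite /vw fmorphV f_t1.
- move=> t ht n0 n1; rewrite /vw fmorphV f_other ?win_lt //.
  - by move/win_inj; lia.
  - by move/win_inj; lia.
Qed.

Lemma fA_Om t : fA (Om t) = Omega N D (1 - f (vw t)).
Proof. by rewrite /Om -[LHS]cmapE cmap_Omega rmorphB rmorph1. Qed.

Lemma Om_swapped : swapped W t0 fA Om.
Proof. by case: vw_swapped => h1 h2 h3; split=> [||t *]; rewrite fA_Om ?h1 ?h2 ?h3. Qed.

Lemma rowF_swapped h k : swapped W t0 fA (rowF h k).
Proof.
rewrite /rowF; case: ifP => _; first exact: Om_swapped.
case: vw_swapped => h1 h2 h3.
have E c e : fA (io ((- c) ^+ e)) = io ((- f c) ^+ e).
  by rewrite -rmorphN -rmorphXn; apply: map_mpolyC.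
by split=> [||t *]; rewrite E ?h1 ?h2 ?h3.
Qed.

(** The exchanged nodes are either both inside the product or both outside it. *)
Lemma fA_prod_Om : t0.+1 != a ->
  fA (\prod_(t < a) Om t) = \prod_(t < a) Om t.
Proof.
move=> ne; have [h0 h1 h2] := Om_swapped; rewrite rmorph_prod.
have [hlt|hge] := ltnP t0.+1 a; last first.
  by apply: eq_bigr => t _; apply: h2; have := ltn_ord t; lia.
apply: (@prod_swap _ Om (fun t => fA (Om t)) a t0 hlt h0 h1).
by move=> t ta; apply: h2; lia.
Qed.

(** Positions [t0] and [t0.+1] carry the indices n and n + 1, and only the first is in the product.
    The factor Omega(b_1)/Omega(b_n) of s_0 replaces [Om t0] by [Om t0.+1], up to terms of degree
    above [D]. *)
Lemma fA_prod_Om_last : t0.+1 = a ->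
  eqt D (\prod_(t < a) Om t * (Om t0.+1 * Omega_inv N (1 - vw t0)))
        (fA (\prod_(t < a) Om t)).
Proof.
move=> e; have [h0 h1 h2] := Om_swapped; 
have E (F : nat -> A) : \prod_(t < a) F t = \prod_(t < t0) F t * F t0.
  by rewrite -e big_ord_recr.
rewrite !E rmorphM h0.
have -> : fA (\prod_(t < t0) Om t) = \prod_(t < t0) Om t.
  rewrite rmorph_prod; apply: eq_bigr => t _; apply: h2; have := ltn_ord t; lia.
rewrite -mulrA; apply: eqtM (@eqt_refl _ _ _ _) _.
rewrite mulrCA -[X in eqt _ _ X]mulr1; apply: eqtM (@eqt_refl _ _ _ _) _.
exact: Omega_invK.
Qed.

Variable i : nat.
Hypothesis hi : i = win t0.+1.

Lemma win_pred : ((i + n.-1) %% n)%N = win t0.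
Proof.
rewrite hi /win modnDml; have -> : (n - a + t0.+1 + n.-1 = n - a + t0 + n)%N by lia.
by rewrite modnDr.
Qed.

Lemma win_eq0 : (i == 0%N) = (t0.+1 == a).
Proof.
rewrite hi /win; apply/eqP/eqP => [|->]; last by rewrite subnK ?modnn //; lia.
have [h|h] := ltnP (n - a + t0.+1) n; first by rewrite modn_small //; lia.
have -> : (n - a + t0.+1 = (t0.+1 - a) + n)%N by lia.
by rewrite modnDr modn_small; lia.
Qed.

Lemma ealphaE : ealpha n i = vw t0.+1 / vw t0.
Proof.
have E1 := win_pred; have hin : (i < n)%N by rewrite hi win_lt.
have -> : vw t0.+1 / vw t0 = xv n ((i + n.-1) %% n) / xv n i.
  by rewrite /vw invrK mulrC E1 hi.
rewrite /ealpha; case: eqP => [->|i0].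
  rewrite (@eaE n n%:Z n.-1 0); last by lia.
  by rewrite (@eaE n 1 0 0) ?add0n ?mod0n.
rewrite (@eaE n i%:Z i.-1 0); last by lia.
rewrite (@eaE n i.+1%:Z i 0); last by lia.
have -> : (i + n.-1 = i.-1 + n)%N by lia.
by rewrite modnDr [in X in _ = _ / X](_ : i = i %% n)%N // modn_small.
Qed.

Hypothesis f_coef : f =1 (if i == 0%N then @stheta_coef n else @s_coef n i).

Lemma prod_Om_s_op (g : A) :
  eqt D (\prod_(t < a) Om t * s_op D i g) (fA (\prod_(t < a) Om t * g)).
Proof.
rewrite rmorphM /s_op; move: f_coef; rewrite win_eq0.
case: eqP => [e|/eqP ne] hf.
  rewrite -(eq_cmap hf) cmapE.
  have i0 : i = 0%N by apply/eqP; rewrite win_eq0 e.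
  have E1 : bb n 1 = 1 - vw t0.+1.
    by rewrite /bb (@eaE n 1 0 0) // /vw -hi i0 mod0n.
  have E2 : bb n n%:Z = 1 - vw t0.
    rewrite /bb (@eaE n n%:Z n.-1 0) ?mul0r ?addr0; last by lia.
    by rewrite /vw -win_pred i0 add0n.
  rewrite E1 E2.
  apply: (@eqt_trans _ _ _ _
      (\prod_(t < a) Om t * (Om t0.+1 * Omega_inv N (1 - vw t0) * fA g))).
    by apply: eqtM (@eqt_refl _ _ _ _) _; apply: eqt_trunc.
  by rewrite mulrA; apply: eqtM (fA_prod_Om_last e) (@eqt_refl _ _ _ _).
by rewrite -(eq_cmap hf) cmapE fA_prod_Om.
Qed.

Lemma prod_Om_D_op (g G : A) : eqt D (\prod_(t < a) Om t * g) G ->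
  eqt D (\prod_(t < a) Om t * D_op D i g)
        (io (1 - vw t0.+1 / vw t0)^-1 * (fA G - G) + G).
Proof.
move=> h; rewrite /D_op ealphaE mulrDr -scalerAr mulrBr [io _ * _]mul_mpolyC.
apply: eqtD (h); apply: eqtZ; apply: eqtB (h).
by apply: eqt_trans (prod_Om_s_op g) _; apply: eqt_map.
Qed.

End Transposition.

Local Notation Dmx h := (ddmx io vw W (rowF h) (rowst h)).

Lemma det_Dmx0 h : h =1 (fun=> 0%N) -> \det (Dmx h) = \prod_(t < a) Om t.
Proof.
move=> h0.
have st0 i : rowst h i = i by rewrite /rowst h0 subn0; case: ifP.
rewrite -det_tr det_trig; last first.
  by apply/is_trig_mxP => i j ij; rewrite !mxE st0 /ddrow ij.
pose G i := if (i < a)%N then Om i else 1.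
have E (i : 'I_W) : (Dmx h)^T i i = G i.
  rewrite !mxE st0 /ddrow ltnn subnn /= /rowF /G.
  by case: ifP => // _; rewrite h0 expr0 rmorph1.
rewrite (eq_bigr _ (fun i _ => E i)) -(big_mkord xpredT G) (@big_cat_nat _ _ _ a) //=.
rewrite [X in _ * X]big_nat_cond [X in _ * X]big1 => [|i /andP[/andP[ha _] _]]; last first.
  by rewrite /G ltnNge ha.
rewrite mulr1 big_mkord; apply: eq_bigr => i _.
by rewrite /G ltn_ord.
Qed.

Section Box.

Variables (h : nat -> nat) (s : nat).
Hypothesis h_le : forall j, (0 < j)%N -> (h j <= a)%N.
Hypothesis h_antitone : forall j k, (0 < j <= k)%N -> (h k <= h j)%N.
Hypotheses (s_gt0 : (0 < s)%N) (s_le : (a + s <= W)%N) (hs_lt : (h s < a)%N).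

(** [s0] is the dagger row of column [s]. It starts at [t0.+1] before the new box and at [t0] after
    it. *)
Let s0 := (a + s).-1.
Let t0 := (s0 - h s).-1.
Let h' j := (h j + (s == j))%N.

Lemma Dmx_add_box :
  Dmx h' = ddmx io vw W (upd (rowF h) s0 (fun t => - io (vw t) * rowF h s0 t))
             (upd (rowst h) s0 t0).
Proof.
apply/matrixP => i j; rewrite !mxE /upd.
have [E|ne] := eqVneq (i : nat) s0; last first.
  congr (ddrow io vw _ _ _); rewrite /rowF /rowst /h'; case: ltnP => // ai.
    by have -> : (s == (i - a).+1) = false by [rewrite /s0 in ne; lia]; rewrite addn0.
  by have -> : (s == (i - a).+1) = false by [rewrite /s0 in ne; lia]; rewrite addn0.
have e1 : ((s0 - a).+1 = s)%N by rewrite /s0; lia.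
have e2 : (s0 < a)%N = false by rewrite /s0; lia.
rewrite E /rowF /rowst e2 e1 /h' eqxx.
have -> : (s0 - (h s + true) = t0)%N by rewrite /t0 /s0; lia.
rewrite /ddrow; case: ifP => // _; apply: eq_dd => t.
by rewrite addn1 exprS rmorphM rmorphN.
Qed.

Lemma Dmx_step (i : nat) (g : A) : i = win t0.+1 ->
  eqt D (\prod_(t < a) Om t * g) (\det (Dmx h)) ->
  eqt D (\prod_(t < a) Om t * D_op D i g) (\det (Dmx h')).
Proof.
move=> hi hg; have ht0 : (t0.+1 < W)%N by rewrite /t0 /s0; lia.
have hin : (i < n)%N by rewrite hi win_lt.
have [f []] := s_coef_rmorphism n_gt1 hin.
move=> hf f0 f1 f2; rewrite (win_pred ht0 hi) hi in f0 f1 f2.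
have H := prod_Om_D_op ht0 f0 f1 f2 hi hf hg.
apply: (eqt_trans H); rewrite Dmx_add_box.
pose fA := (map_mpoly f : {rmorphism A -> A}).
have fA_io c : fA (io c) = io (f c) by apply: map_mpolyC.
have rF k : (k < W)%N -> swapped W t0 fA (rowF h k).
  by move=> _; exact (rowF_swapped ht0 f0 f1 f2 h k).
have st_lt k : (k < W)%N -> (rowst h k < W)%N by rewrite /rowst; case: ifP; lia.
have s0_lt : (s0 < W)%N by rewrite /s0; lia.
have st_s0 : rowst h s0 = t0.+1.
  rewrite /rowst; have -> : (s0 < a)%N = false by rewrite /s0; lia.
  have -> : ((s0 - a).+1 = s)%N by rewrite /s0; lia.
  by rewrite /t0 /s0; lia.
(* As [h] is antitone, the starts of the dagger rows strictly increase, so only an Omega row can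
   share the start [t0.+1], and the row above it is then an Omega row too. *)
have st_other k : (k < W)%N -> k <> s0 -> rowst h k = t0.+1 ->
    [/\ k = t0.+1, t0 <> s0, rowst h t0 = t0 & rowF h t0 = rowF h t0.+1].
  move=> kW ks; rewrite /rowst /rowF; case: ltnP => ka e.
    have e' : (t0 < a)%N by lia.
    by rewrite e' -e ka; split=> //; rewrite /t0 /s0; lia.
  exfalso; move: e ks; rewrite /t0 /s0.
  have [hk|hk] := leqP (k - a).+1 s.
    have := @h_antitone (k - a).+1 s; rewrite hk => /(_ isT).
    by have := @h_le (k - a).+1 isT; lia.
  have := @h_antitone s (k - a).+1; rewrite s_gt0 (ltnW hk) => /(_ isT).
  by lia.
have v0 : vw t0 != 0 by rewrite invr_eq0 xv_neq0_lt // win_lt.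
have S := @det_ddmx_step _ _ io vw W vw_inj f fA fA_io t0 ht0 (vw_swapped ht0 f0 f1 f2)
  (rowF h) (rowst h) s0 rF st_lt s0_lt st_s0 st_other v0.
by rewrite -S; apply: eqt_refl.
Qed.

End Box.
End Window.

(** * The matrix of the partition and the induction over its boxes *)

(** Here m = i - j, so [dd_exp] yields (-1)^m h_m in the nodes from the row's start up to column
    [j]; taken from the last to the first, these are the entries of [dset]. *)
Lemma Mrow_daggerE n N a W la (i j : nat) : (1 < n)%N -> (W <= n)%N -> (a <= W)%N ->
  size la = a -> (a <= i)%N -> (i < W)%N -> (j < W)%N ->
  (Mrow_dagger n la (i - a).+1 (n - a + 1 + j)%N%:Z)%:MP_[N] =
  ddrow (@mpolyC N (Kf n) : {rmorphism Kf n -> {mpoly (Kf n)[N]}}) (vw n a)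
    (fun t => ((- vw n a t) ^+ conj_part la (i - a).+1)%:MP)
    (i - conj_part la (i - a).+1) j.
Proof.
move=> n_gt1 W_le a_le la_size ia hi hj.
set s := (i - a).+1; have h_le : (conj_part la s <= a)%N by by rewrite -la_size; apply: count_size.
rewrite /Mrow_dagger; set h := conj_part la s in h_le *.
have -> : n%:Z + s%:Z - (n - a + 1 + j)%N%:Z = i%:Z - j%:Z :> int.
  by rewrite /s; lia.
rewrite /ddrow; have [ji|ji] := ltnP j (i - h).
  have -> : (0 <= i%:Z - j%:Z) && (i%:Z - j%:Z <= h%:Z) = false by lia.
  by rewrite mpolyC0.
rewrite (dd_exp _ (vw_inj n_gt1 W_le a_le)); last by lia.
have -> : (j - (i - h) <= h)%N = (j <= i)%N by lia.
have -> : (0 <= i%:Z - j%:Z) && (i%:Z - j%:Z <= h%:Z) = (j <= i)%N by lia.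
case: leqP => // ij.
have -> : absz (i%:Z - j%:Z) = (i - j)%N by lia.
have -> : (h - (j - (i - h)) = i - j)%N by lia.
congr (_ (_ * _)).
have -> : (if (i - j)%N == 0%N then 1 else hcompl (i - j) (dset n la (i - j) s)) =
    hcompl (i - j) (dset n la (i - j) s).
  by case: eqP => // ->; rewrite hcompl0.
congr (hcompl _ _); rewrite /dset -/h.
apply: (@eq_from_nth _ 0) => [|x].
  by rewrite !size_map size_rev !size_iota; lia.
rewrite size_map size_iota => hx.
rewrite (nth_map 0%N) ?size_iota // nth_iota //.
rewrite (nth_map 0%N) ?size_rev ?size_iota; last by lia.
rewrite nth_rev ?size_iota; last by lia.
rewrite nth_iota; last by lia.
rewrite /vw /win; congr (_^-1).
rewrite (@eaE n _ (n - a + (i - h + (j - (i - h) - x))) 1); last first.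
  by rewrite /s; lia.
by congr (xv n (_ %% n)); lia.
Qed.

Lemma MmatE n N D la : (1 < n)%N -> k_small n la ->
  Mmat n N D la =
  ddmx (@mpolyC N (Kf n) : {rmorphism Kf n -> {mpoly (Kf n)[N]}}) (vw n (size la))
    (size la + head 0%N la)
    (rowF n N D (size la) (conj_part la)) (rowst (size la) (conj_part la)).
Proof.
move=> n_gt1 hsmall; set a := size la; set W := (a + head 0 la)%N.
have W_le : (W <= n)%N by rewrite /W addnC.
have a_le : (a <= W)%N by apply: leq_addr.
apply/matrixP => i j; have hi := ltn_ord i; have hj := ltn_ord j.
rewrite !mxE /rowF /rowst -/a; case: ltnP => ia.
  rewrite ltn_add2l subnDl /ddrow; case: ltnP => // ij.
  have -> : (n - a + 1 + i = (n - a + i).+1)%N by lia.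
  by apply: (@zzE n N D a W).
by apply: (@Mrow_daggerE n N a W).
Qed.

Unset Implicit Arguments.

Theorem theorem5p1 (n : nat) (hn : (2 <= n)%N) (la : seq nat)
  (hpart : is_partition la) (hsmall : k_small n la) (hne : la != [::])
  (w : seq (nat * nat)) (hw : building_seq la w) (N D : nat) :
  @trunc n N D (xi n N D la * gtilde n N D w) = @trunc n N D (\det (Mmat n N D la)).
Proof.
rewrite MmatE //; apply/trunc_eqt.
set a := size la; pose W := (a + head 0 la)%N.
have W_le : (W <= n)%N by rewrite /W addnC.
have a_le : (a <= W)%N by apply: leq_addr.
rewrite (@xiE n N D a W) //.
pose M h := ddmx (@mpolyC N (Kf n) : {rmorphism Kf n -> {mpoly (Kf n)[N]}}) (vw n a) W
  (rowF n N D a h) (rowst a h).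
(* The matrix keeps the size given by [la] throughout; columns still empty contribute rows of
   divided differences of u^0, which have a single entry 1 on the diagonal. *)
suff H k : (k <= size w)%N ->
    eqt D (\prod_(t < a) Om n N D a t * gtilde n N D (take k w)) (\det (M (height (take k w)))).
  have := H _ (leqnn _); rewrite take_size.
  have -> // : M (height w) = M (conj_part la).
  apply/matrixP => i j; rewrite !mxE /rowF /rowst.
  by rewrite (building_height hpart hw).
elim: k => [|k IH] hk.
  rewrite take0 /gtilde /= mulr1 det_Dmx0 //; exact: eqt_refl.
have [-> hb hr] := building_step hw hk.
move: hb hr; case: (nth _ _ _) => r s /= hb hr.
have /and4P[r0 ra s0 sb] := in_diagram_size hpart hb.
rewrite /gtilde -cats1 foldl_cat /= -/(gtilde n N D (take k w)) cats1.
have -> : M (height (rcons (take k w) (r, s))) =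
    M (fun j => height (take k w) j + (s == j))%N.
  by apply/matrixP => i j; rewrite !mxE /rowF /rowst height_rcons.
have st := stacked_take hw (ltnW hk).
apply: (@Dmx_step n N D a W) => //.
- by move=> j j0; apply: leq_trans (height_take_le hpart hw k j0) (count_size _ _).
- by move=> j j' jj; apply: stacked_antitone.
- by rewrite /W; lia.
- by lia.
(* Since r is the old height plus 1, position [t0.+1] is a + s - r, and [win] sends it to n + s - r
   modulo n, the residue of the box. *)
- rewrite /residue /= -[RHS]/(absz (Posz (win _ _ _))) /win -modz_nat; congr absz.
  by rewrite -(modzMDl 1 (s%:Z - r%:Z)); congr (_ %% _)%Z; lia.
exact: IH (ltnW hk).
Qed.
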